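(* Let $\mathcal{P} = \{P_1, \dots, P_k\}$ be a set of polygons in $\mathbb{R}^2$ (regarded via their interiors) and let $p_1, \dots, p_N \in \mathbb{R}^2$ be points none of which lies in the interior of any $P_j$. For $q \in \mathbb{R}^2$ let $d(p_i, q)$ be the minimum length of a path from $p_i$ to $q$ that does not intersect the interior of any $P_j \in \mathcal{P}$. Let $C$ be the convex hull of the union of the points $p_1,\dots,p_N$ and the polygons $P_1,\dots,P_k$. Then the minimum over $q\in\mathbb{R}^2$ of $\sum_{i=1}^N d(p_i, q)$ occurs when $q$ lies in $C$ (inside it or on its boundary); that is, every minimizer lies in $C$.
   Context: Polygons act as obstacles: admissible paths may not pass through the interior of any polygon. The distance $d(x,y)$ is the infimum of Euclidean lengths of admissible paths from $x$ to $y$. *)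

(* Defs.v *)
From HB Require Import structures.
From mathcomp Require Import all_boot all_order all_algebra.
From mathcomp Require Import all_classical all_reals all_analysis.
Set Implicit Arguments.
Unset Strict Implicit.
Unset Printing Implicit Defensive.
Import Order.TTheory GRing.Theory Num.Theory.
Import numFieldNormedType.Exports.
Local Open Scope classical_set_scope.
Local Open Scope ring_scope.

(* The norm that the library puts on 'rV[R]_2 is the sup norm. It induces the
   usual topology, but Euclidean lengths must be computed separately. *)
Definition edist (R : realType) (x y : 'rV[R]_2) : R :=
  Num.sqrt (\sum_(i < 2) (x ord0 i - y ord0 i) ^+ 2).

Definition segment (R : realType) (a b : 'rV[R]_2) : set 'rV[R]_2 :=
  [set (1 - t) *: a + t *: b | t in `[0, 1]%classic].

Definition convex_hull (R : realType) (A : set 'rV[R]_2) : set 'rV[R]_2 :=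
  smallest (@convex_set R 'rV[R]_2) A.

(* A simple polygon, given by the cyclic sequence of its vertices. In
   edges_adjacent the indices i and i + 1 are cyclic. *)
Record polygon (R : realType) := Polygon {
  nb_vertices : nat;
  nb_vertices_ge3 : (3 <= nb_vertices)%N;
  vertex : 'I_nb_vertices -> 'rV[R]_2;
  vertex_inj : injective vertex;
  edges_adjacent : forall i,
    segment (vertex i) (vertex (ordS i)) `&`
    segment (vertex (ordS i)) (vertex (ordS (ordS i))) =
    [set vertex (ordS i)];
  edges_disjoint : forall i j, i != j -> j != ordS i -> i != ordS j ->
    segment (vertex i) (vertex (ordS i)) `&`
    segment (vertex j) (vertex (ordS j)) = set0
}.

Definition polygon_boundary (R : realType) (P : polygon R) : set 'rV[R]_2 :=
  \bigcup_i segment (vertex (p := P) i) (vertex (p := P) (ordS i)).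

(* The closed region: the boundary curve together with the points it encloses,
   i.e. those whose component in the complement of the curve is bounded. *)
Definition polygon_region (R : realType) (P : polygon R) : set 'rV[R]_2 :=
  polygon_boundary P `|`
  [set x | (~` polygon_boundary P) x /\
           bounded_set (connected_component (~` polygon_boundary P) x)].

(* Here s is such that 0 :: s is a subdivision 0 = t_0 < ... < t_n = 1. *)
Definition path_length (R : realType) (g : R -> 'rV[R]_2) : \bar R :=
  ereal_sup [set (\sum_(0 <= m < size s)
      edist (g (nth 1 (0 :: s) m.+1)) (g (nth 1 (0 :: s) m)))%:E
    | s in itv_partition (0 : R) 1].

Definition admissible_path (R : realType) (k : nat) (P : 'I_k -> polygon R)
    (x y : 'rV[R]_2) (g : R -> 'rV[R]_2) : Prop :=
  [/\ {within `[0, 1], continuous g}, g 0 = x, g 1 = y &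
      forall t j, t \in `[0, 1] -> ~ interior (polygon_region (P j)) (g t)].

(* The value is +oo when no admissible path, or only non-rectifiable ones,
   join x to y; in particular when y is interior to some polygon. *)
Definition obstacle_dist (R : realType) (k : nat) (P : 'I_k -> polygon R)
    (x y : 'rV[R]_2) : \bar R :=
  ereal_inf [set path_length g | g in admissible_path P x y].

Definition total_dist (R : realType) (k N : nat) (P : 'I_k -> polygon R)
    (p : 'I_N -> 'rV[R]_2) (q : 'rV[R]_2) : \bar R :=
  (\sum_(i < N) obstacle_dist P (p i) q)%E.

(* Overlapping polygons may separate the points p_i, so that a function such as
   total_dist P p is identically +oo; it then has no minimizer. *)
Definition is_minimizer (R : realType) (F : 'rV[R]_2 -> \bar R)
    (q : 'rV[R]_2) : Prop :=
  (F q < +oo)%E /\ forall q', (F q <= F q')%E.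

(* Main.v *)
Require Import Defs.
From HB Require Import structures.
From mathcomp Require Import all_boot all_order all_algebra.
From mathcomp Require Import all_classical all_reals all_analysis.
From mathcomp Require Import ring lra.

(* A minimizer q outside the hull is strictly separated, by a unit vector u and
   a level c, from the compact hull of the finitely many points p_i and polygon
   vertices. The half-plane H = {u.x <= c} then contains every polygon region,
   since a point enclosed by the boundary but outside H could escape to infinity
   along u. The nearest-point map onto H sends admissible paths to admissible
   paths. It splits off the orthogonal component: a step of length d becomes a
   step of length l, with l^2 + e^2 <= d^2 where e is the change in height above
   H. Minkowski's inequality sums this along a path from p_i to q into
   L'^2 + h^2 <= L^2, where h > 0 is the height of q above H, so that every
   distance d(p_i, .) strictly decreases when q is moved to H. *)

Set Implicit Arguments.
Unset Strict Implicit.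
Unset Printing Implicit Defensive.
Import Order.TTheory GRing.Theory Num.Theory.
Import numFieldNormedType.Exports.
Local Open Scope classical_set_scope.
Local Open Scope ring_scope.

(* The unqualified name denotes the extended distance of mathcomp-analysis. *)
Local Notation edist := Defs.edist.

(** * Dot product and Euclidean distance in the plane *)

Definition dot (R : realType) (x y : 'rV[R]_2) : R :=
  \sum_(i < 2) x ord0 i * y ord0 i.

Lemma dotE (R : realType) (x y : 'rV[R]_2) :
  dot x y = x ord0 ord0 * y ord0 ord0 + x ord0 ord_max * y ord0 ord_max.
Proof.
rewrite /dot !big_ord_recl big_ord0 addr0.
by have -> : lift ord0 ord0 = ord_max :> 'I_2 by exact/val_inj.
Qed.

Lemma dotC (R : realType) (x y : 'rV[R]_2) : dot x y = dot y x.
Proof. by rewrite !dotE; ring. Qed.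

Lemma dotDr (R : realType) (x y z : 'rV[R]_2) :
  dot x (y + z) = dot x y + dot x z.
Proof. by rewrite !dotE !mxE; ring. Qed.

Lemma dotBr (R : realType) (x y z : 'rV[R]_2) :
  dot x (y - z) = dot x y - dot x z.
Proof. by rewrite !dotE !mxE; ring. Qed.

Lemma dotZr (R : realType) (a : R) (x y : 'rV[R]_2) :
  dot x (a *: y) = a * dot x y.
Proof. by rewrite !dotE !mxE; ring. Qed.

Lemma dotxx_ge0 (R : realType) (x : 'rV[R]_2) : 0 <= dot x x.
Proof. by rewrite dotE addr_ge0// -expr2 sqr_ge0. Qed.

Lemma dotxx_gt0 (R : realType) (x : 'rV[R]_2) : (0 < dot x x) = (x != 0).
Proof.
rewrite lt_neqAle dotxx_ge0 andbT eq_sym; congr negb.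
apply/eqP/eqP => [|->]; last by rewrite dotE !mxE mul0r addr0.
rewrite dotE => /eqP; rewrite -!expr2 paddr_eq0 ?sqr_ge0// !sqrf_eq0.
case/andP=> /eqP x0 /eqP x1; apply/rowP => i; rewrite mxE.
by case: i => -[|[|//]] hi; [rewrite -x0|rewrite -x1]; congr (x _ _); exact/val_inj.
Qed.

Lemma edistE (R : realType) (x y : 'rV[R]_2) :
  edist x y = Num.sqrt (dot (x - y) (x - y)).
Proof.
by congr Num.sqrt; apply: eq_bigr => i _; rewrite !mxE expr2.
Qed.

Lemma edist_ge0 (R : realType) (x y : 'rV[R]_2) : 0 <= edist x y.
Proof. exact: sqrtr_ge0. Qed.

Lemma sqr_edist (R : realType) (x y : 'rV[R]_2) :
  edist x y ^+ 2 = dot (x - y) (x - y).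
Proof. by rewrite edistE sqr_sqrtr// dotxx_ge0. Qed.

Lemma dot_continuous (R : realType) (u : 'rV[R]_2) :
  continuous (dot u : 'rV[R]_2 -> R).
Proof.
have H (i : 'I_2) : continuous (fun x : 'rV[R]_2 => u ord0 i * x ord0 i).
  move=> x; exact: (continuousM (@cst_continuous 'rV[R]_2 R _ x)
    (@coord_continuous R 1 2 ord0 i x)).
by rewrite (funext (dotE u)) => x; exact: (continuousD (H ord0 x) (H ord_max x)).
Qed.

Lemma dotxx_continuous (R : realType) :
  continuous (fun x : 'rV[R]_2 => dot x x).
Proof.
have H (i : 'I_2) : continuous (fun x : 'rV[R]_2 => x ord0 i * x ord0 i).
  move=> x; have c := @coord_continuous R 1 2 ord0 i x.
  exact: (continuousM c c).
rewrite (funext (fun x => dotE x x)) => x.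
exact: (continuousD (H ord0 x) (H ord_max x)).
Qed.

(** * Compactness of the convex hull of finitely many points *)

Lemma convex_setP (R : realType) (A : set 'rV[R]_2) :
  @convex_set R 'rV[R]_2 A <->
  forall x y t, A x -> A y -> 0 <= t <= 1 -> A ((1 - t) *: x + t *: y).
Proof.
split=> [cA x y t Ax Ay t01|cA x y t /set_mem Ax /set_mem Ay]; last first.
  apply/mem_set; rewrite /conv /= addrC.
  by apply: cA Ay Ax _; rewrite ge0 le1.
have t01' : t \in `[0, 1] by rewrite in_itv.
(* The library's convex combination gives the weight [t] to its first point, hence the swap of [x]
   and [y]. *)
have := cA y x (Itv01 (andP t01).1 (andP t01).2) (mem_set Ay) (mem_set Ax).
by move=> /set_mem; rewrite /conv /= addrC.
Qed.

Lemma convex_hull_sub (R : realType) (A B : set 'rV[R]_2) :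
  A `<=` B -> convex_hull A `<=` convex_hull B.
Proof. by move=> AB x Ax D [cD BD]; apply: Ax; split => // y /AB /BD. Qed.

Lemma convex_convex_hull (R : realType) (A : set 'rV[R]_2) :
  @convex_set R 'rV[R]_2 (convex_hull A).
Proof.
apply/convex_setP => x y t Ax Ay t01 D [cD AD].
by move/convex_setP: (cD); apply => //; [apply: Ax|apply: Ay].
Qed.

(** The union of the segments from [v] to points of [A], written as an image of a product so that
    compactness carries over. *)
Definition join_point (R : realType) (v : 'rV[R]_2) (A : set 'rV[R]_2) :=
  (fun z : R * 'rV[R]_2 => (1 - z.1) *: v + z.1 *: z.2) @` (`[0, 1] `*` A).

Lemma compact_join_point (R : realType) (v : 'rV[R]_2) (A : set 'rV[R]_2) :
  compact A -> compact (join_point v A).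
Proof.
move=> cA; have cI := compact_setX (@segment_compact R 0 1) cA.
apply: continuous_compact cI; apply: continuous_subspaceT => z.
have c1 : {for z, continuous (fst : R * 'rV[R]_2 -> R)} by exact: cvg_fst.
have c2 : {for z, continuous (snd : R * 'rV[R]_2 -> 'rV[R]_2)} by exact: cvg_snd.
have k1 := @cst_continuous (R * 'rV[R]_2)%type R 1 z.
have kv := @cst_continuous (R * 'rV[R]_2)%type 'rV[R]_2 v z.
exact: (continuousD (continuousZ (continuousB k1 c1) kv) (continuousZ c1 c2)).
Qed.

(** The point is that the right-hand side is already convex: a combination of points on two segments
    from [v] lies on a segment from [v] to a combination of their endpoints. This makes compactness
    provable by induction on the list. *)
Lemma convex_hull_cons (R : realType) (v : 'rV[R]_2) (s : seq 'rV[R]_2) :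
  convex_hull [set` v :: s] = [set v] `|` join_point v (convex_hull [set` s]).
Proof.
set H := convex_hull [set` s].
have Hv : convex_hull [set` v :: s] v by move=> D [_]; apply; rewrite /= mem_head.
have cH : forall x y t, H x -> H y -> 0 <= t <= 1 -> H ((1 - t) *: x + t *: y).
  by apply/convex_setP; exact: convex_convex_hull.
apply/seteqP; split; last first.
  move=> x [->//|[[t y] [/= + Hy] <-]]; rewrite in_itv /= => t01.
  have /convex_setP := @convex_convex_hull _ [set` v :: s]; apply => //.
  by apply: convex_hull_sub Hy => z /= zs; rewrite in_cons zs orbT.
apply: smallest_sub; last first.
  move=> x /=; rewrite in_cons => /predU1P[->|xs]; [by left|right].
  exists (1, x) => /=; last by rewrite subrr scale0r add0r scale1r.
  by split => /=; [rewrite in_itv /= ler01 lexx|move=> D [_]; exact].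
have VI x : ([set v] `|` join_point v H) x <->
    x = v \/ exists t y, [/\ 0 <= t <= 1, H y & x = (1 - t) *: v + t *: y].
  split=> -[->|]; [by left| |by left|].
    by case=> -[t y] [/= + Hy] <-; rewrite in_itv /= => t01; right; exists t, y.
  by case=> t [y] [t01 Hy ->]; right; exists (t, y); split => //=; rewrite in_itv.
apply/convex_setP => x y a /VI Vx /VI Vy /andP[a0 a1]; apply/VI.
(* If [H] is empty, so is the join, and only [v] remains. *)
have [Hs|Hs] := pselect (H !=set0); last first.
  case: Vx => [->|[t [z [_ Hz]]]]; last by exfalso; apply: Hs; exists z.
  case: Vy => [->|[t [z [_ Hz]]]]; last by exfalso; apply: Hs; exists z.
  by left; rewrite -scalerDl subrK scale1r.
(* Once [H] has a point, [v] too has the segment form, with parameter 0. *)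
have {}VI z : (z = v \/ exists t y, [/\ 0 <= t <= 1, H y & z = (1 - t) *: v + t *: y]) ->
    exists t y, [/\ 0 <= t <= 1, H y & z = (1 - t) *: v + t *: y].
  case=> [->|//]; case: Hs => w Hw; exists 0, w; split => //.
    by rewrite lexx ler01.
  by rewrite subr0 scale1r scale0r addr0.
have [t [x' [/andP[t0 t1] Hx ->]]] := VI _ Vx.
have [r [y' [/andP[r0 r1] Hy ->]]] := VI _ Vy.
right.
have ar0 : 0 <= a * r by exact: mulr_ge0.
have at0 : 0 <= (1 - a) * t by rewrite mulr_ge0// subr_ge0.
(* This is the total weight on [x'] and [y']. If it vanishes the point is [v]; otherwise their two
   weights are normalized by it. *)
have [T0|T0] := eqVneq ((1 - a) * t + a * r) 0.
  move/eqP: T0; rewrite paddr_eq0// => /andP[/eqP e1 /eqP e2].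
  exists 0, x'; split => //; first by rewrite lexx ler01.
  apply/rowP => i; rewrite !mxE.
  have -> : (1 - a) * ((1 - t) * v ord0 i + t * x' ord0 i) +
     a * ((1 - r) * v ord0 i + r * y' ord0 i) = (1 - ((1 - a) * t + a * r)) * v ord0 i
      + ((1 - a) * t) * x' ord0 i + (a * r) * y' ord0 i by ring.
  by rewrite e1 e2; ring.
have Tp : 0 < (1 - a) * t + a * r by rewrite lt_neqAle eq_sym T0 addr_ge0.
exists ((1 - a) * t + a * r), ((1 - (a * r) / ((1 - a) * t + a * r)) *: x' +
   ((a * r) / ((1 - a) * t + a * r)) *: y'); split.
- rewrite (ltW Tp) /=.
  have : (1 - a) * t <= 1 - a by rewrite ler_piMr// subr_ge0.
  have : a * r <= a by rewrite ler_piMr.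
  lra.
- apply: cH => //; rewrite divr_ge0 ?(ltW Tp)//= ler_pdivrMr// mul1r; lra.
- apply/rowP => i; rewrite !mxE; field.
  exact: T0.
Qed.

Lemma compact_convex_hull_seq (R : realType) (s : seq 'rV[R]_2) :
  compact (convex_hull [set` s]).
Proof.
elim: s => [|v s IH].
  rewrite (_ : convex_hull _ = set0); first exact: compact0.
  by apply/seteqP; split => // x /(_ set0); apply; split=> // y z t /set_mem.
rewrite convex_hull_cons; apply: compactU; first exact: compact_set1.
exact: compact_join_point.
Qed.

(** * Strict separation of a point from a compact convex set *)

Lemma strict_separation (R : realType) (H : set 'rV[R]_2) (q : 'rV[R]_2) :
  compact H -> H !=set0 -> @convex_set R 'rV[R]_2 H -> ~ H q ->
  exists u c, [/\ dot u u = 1, forall x, H x -> dot u x <= c & c < dot u q].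
Proof.
move=> cH H0 /convex_setP vH Hq.
have cf : continuous (fun x : 'rV[R]_2 => dot (x - q) (x - q)).
  move=> x; have k1 := @cst_continuous 'rV[R]_2 'rV[R]_2 q x.
  have k2 : {for x, continuous (@idfun 'rV[R]_2)} by exact: cvg_id.
  exact: (continuous_comp (continuousB k2 k1) (@dotxx_continuous R (x - q))).
(* [y] is a point of [H] nearest to [q]; the separating line passes through [y], orthogonally to
   [q - y]. *)
have [y /set_mem Hy ymin] := compact_EVT_min H0 cH (continuous_subspaceT cf).
pose w := q - y.
have w0 : 0 < dot w w.
  by rewrite dotxx_gt0 subr_eq0; apply/eqP => qy; apply: Hq; rewrite qy.
have obtuse x : H x -> dot w (x - y) <= 0.
  move=> Hx; rewrite leNgt; apply/negP => a0.
  have b0 := dotxx_ge0 (x - y).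
  set a := dot w (x - y) in a0; set b := dot (x - y) (x - y) in b0.
  have ab0 : 0 < a + b by rewrite ltr_wpDr.
  (* Moving from [y] towards [x] by [t] changes the squared distance to [q] by
     [t * (t * b - 2 * a)]. The choice [a / (a + b)] makes this negative and stays in the unit
     interval, whereas the optimal [a / b] may exceed 1. *)
  have t0 : 0 < a / (a + b) by rewrite divr_gt0.
  have t1 : a / (a + b) <= 1 by rewrite ler_pdivrMr// mul1r lerDl.
  have t01 : 0 <= a / (a + b) <= 1 by rewrite (ltW t0).
  have := ymin _ (mem_set (vH y x _ Hy Hx t01)); apply/negP; rewrite -ltNge.
  set t := a / (a + b) in t0 t1 *.
  have -> : dot ((1 - t) *: y + t *: x - q) ((1 - t) *: y + t *: x - q) =
      dot (y - q) (y - q) + t * (t * b - 2 * a).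
    by rewrite /a /b /w !dotE !mxE; ring.
  rewrite gtrDl pmulr_rlt0//.
  have -> : t * b - 2 * a = - a - t * a.
    by rewrite /t; field; rewrite gt_eqF.
  have : 0 < t * a by rewrite mulr_gt0.
  by lra.
have s0 : 0 < Num.sqrt (dot w w) by rewrite sqrtr_gt0.
have ss : Num.sqrt (dot w w) ^+ 2 = dot w w by rewrite sqr_sqrtr// ltW.
exists ((Num.sqrt (dot w w))^-1 *: w), (dot ((Num.sqrt (dot w w))^-1 *: w) y).
split.
- rewrite dotZr dotC dotZr mulrA -invfM -expr2 ss mulVf//; exact: lt0r_neq0.
- move=> x Hx; rewrite -subr_le0 -dotBr dotC dotZr dotC.
  by rewrite pmulr_rle0 ?invr_gt0// obtuse.
- by rewrite -subr_gt0 -dotBr dotC dotZr pmulr_rgt0 ?invr_gt0.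
Qed.

(** * Polygon regions stay in any half-plane containing the vertices *)

Lemma polygon_region_halfplane (R : realType) (Q : polygon R) (u : 'rV[R]_2)
    (c : R) : dot u u = 1 -> (forall i, dot u (vertex (p := Q) i) <= c) ->
  forall x, polygon_region Q x -> dot u x <= c.
Proof.
move=> u1 Vc.
have bc z : polygon_boundary Q z -> dot u z <= c.
  move=> [i _ [t /=]]; rewrite in_itv /= => /andP[t0 t1] <-.
  rewrite dotDr !dotZr.
  have := Vc i; have := Vc (ordS i); nra.
move=> x [/bc//|[Qx [M [_ bM]]]]; rewrite leNgt; apply/negP => xc.
have {}bM := bM (M + 1) (ltr_pwDr ltr01 (lexx M)).
have u0 : 0 < `|u|.
  by rewrite normr_gt0 -dotxx_gt0 u1.
(* This ray stays above level [c], so it misses the boundary; being connected, it lies in the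
   supposedly bounded component of [x]. *)
pose ray := (fun t : R => x + t *: u) @` `[0, +oo[.
have rayB : ray `<=` ~` polygon_boundary Q.
  move=> _ [t /= + <-] /bc; rewrite in_itv /= andbT dotDr dotZr u1; lra.
have rayC : connected ray.
  apply: connected_continuous_connected.
    exact/connected_intervalP/interval_is_interval.
  apply: continuous_subspaceT => t.
  have k1 := @cst_continuous R 'rV[R]_2 x t.
  have k2 := @cst_continuous R 'rV[R]_2 u t.
  have k3 : {for t, continuous (@idfun R)} by exact: cvg_id.
  exact: (continuousD k1 (continuousZ k3 k2)).
have rayx : ray x by exists 0; rewrite /= ?in_itv /= ?lexx// scale0r addr0.
have rayK := connected_component_max rayx rayB rayC.
(* Chosen so that [t *: u] has sup norm [|x| + |M| + 2], which puts [x + t *: u] beyond the bound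
   [M + 1]. *)
pose t := (`|x| + `|M| + 2) / `|u|.
have t0 : 0 <= t by rewrite divr_ge0// addr_ge0// addr_ge0.
have /rayK /bM /= : ray (x + t *: u) by exists t => //=; rewrite in_itv /= t0.
have : `|t *: u| <= `|x + t *: u| + `|x|.
  by rewrite -{1}(addrK x (t *: u)) (addrC _ x) ler_normB.
rewrite normrZ ger0_norm// /t divfK ?gt_eqF//.
have := ler_norm M; lra.
Qed.

(** * The nearest-point map onto a half-plane *)

Definition excess (R : realType) (u : 'rV[R]_2) (c : R) (x : 'rV[R]_2) : R :=
  Num.max 0 (dot u x - c).

(** For a unit vector [u], the nearest-point projection onto the half-plane [dot u x <= c]. *)
Definition clamp (R : realType) (u : 'rV[R]_2) (c : R) (x : 'rV[R]_2) :=
  x - excess u c x *: u.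

Lemma excess_id (R : realType) (u : 'rV[R]_2) (c : R) (x : 'rV[R]_2) :
  dot u x <= c -> excess u c x = 0.
Proof. by move=> xc; apply/max_idPl; rewrite subr_le0. Qed.

Lemma clamp_id (R : realType) (u : 'rV[R]_2) (c : R) (x : 'rV[R]_2) :
  dot u x <= c -> clamp u c x = x.
Proof. by move=> xc; rewrite /clamp excess_id// scale0r subr0. Qed.

Lemma dot_clamp (R : realType) (u : 'rV[R]_2) (c : R) (x : 'rV[R]_2) :
  dot u u = 1 -> c <= dot u x -> dot u (clamp u c x) = c.
Proof.
move=> u1 xc; rewrite /clamp /excess max_r ?subr_ge0//.
by rewrite dotBr dotZr u1 mulr1 subKr.
Qed.

Lemma clamp_continuous (R : realType) (u : 'rV[R]_2) (c : R) :
  continuous (clamp u c : 'rV[R]_2 -> 'rV[R]_2).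
Proof.
move=> x.
have k0 : {for x, continuous (@idfun 'rV[R]_2)} by exact: cvg_id.
have k1 := @cst_continuous 'rV[R]_2 'rV[R]_2 u x.
have k2 := @cst_continuous 'rV[R]_2 R c x.
have k3 := @cst_continuous 'rV[R]_2 R 0 x.
have k4 := continuousB (@dot_continuous R u x) k2.
have k5 : {for x, continuous (excess u c)} := continuous_max k3 k4.
exact: (continuousB k0 (continuousZ k5 k1)).
Qed.

(** Expanding the square reduces the claim to [d ^+ 2 <= d * (dot u x - dot u y)], which says that
    the positive part on the line is firmly nonexpansive. *)
Lemma edist_clamp (R : realType) (u : 'rV[R]_2) (c : R) (x y : 'rV[R]_2) :
  dot u u = 1 ->
  edist (clamp u c x) (clamp u c y) ^+ 2 + (excess u c x - excess u c y) ^+ 2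
    <= edist x y ^+ 2.
Proof.
move=> u1; rewrite !sqr_edist.
have -> : clamp u c x - clamp u c y = (x - y) - (excess u c x - excess u c y) *: u.
  by rewrite /clamp; apply/rowP => i; rewrite !mxE; ring.
set d := excess u c x - excess u c y.
have -> : dot (x - y - d *: u) (x - y - d *: u) =
    dot (x - y) (x - y) - 2 * d * dot u (x - y) + d ^+ 2 * dot u u.
  by rewrite !dotE !mxE; ring.
rewrite u1 (dotBr u).
suff : d ^+ 2 <= d * (dot u x - dot u y) by lra.
rewrite /d /excess (_ : dot u x - dot u y = (dot u x - c) - (dot u y - c)); last by ring.
move: (dot u x - c) (dot u y - c) => a b.
have [a0|a0] := leP 0 a; have [b0|b0] := leP 0 b; rewrite -subr_ge0.
- rewrite (_ : _ - _ = 0) //; ring.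
- rewrite (_ : _ - _ = a * - b); [by rewrite mulr_ge0// oppr_ge0 ltW|ring].
- rewrite (_ : _ - _ = b * - a); [by rewrite mulr_ge0// oppr_ge0 ltW|ring].
- rewrite (_ : _ - _ = 0) //; ring.
Qed.

(** * Lengths of projected paths *)

Lemma minkowski_step (R : realType) (a b s l e d : R) :
  0 <= s -> 0 <= d -> a ^+ 2 + b ^+ 2 <= s ^+ 2 -> l ^+ 2 + e ^+ 2 <= d ^+ 2 ->
  (a + l) ^+ 2 + (b + e) ^+ 2 <= (s + d) ^+ 2.
Proof.
move=> s0 d0 ab le.
(* What remains is Cauchy-Schwarz for the vectors [(a, b)] and [(l, e)], proved below by Lagrange's
   identity. *)
suff : a * l + b * e <= s * d by lra.
apply: le_trans (ler_norm _) _.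
rewrite -(@ler_pXn2r _ 2)// ?nnegrE ?mulr_ge0// real_normK ?num_real//.
have : (a * l + b * e) ^+ 2 <= (a ^+ 2 + b ^+ 2) * (l ^+ 2 + e ^+ 2).
  rewrite -subr_ge0 (_ : _ - _ = (a * e - b * l) ^+ 2) ?sqr_ge0//; ring.
move=> /le_trans; apply; rewrite exprMn.
by apply: ler_pM => //; rewrite addr_ge0// sqr_ge0.
Qed.

(** Each step yields a planar vector (projected length, change of excess). The vectors are added by
    Minkowski's inequality, and the changes of excess telescope. *)
Lemma sum_edist_clamp (R : realType) (u : 'rV[R]_2) (c : R)
    (f : nat -> 'rV[R]_2) (n : nat) : dot u u = 1 ->
  (\sum_(0 <= m < n) edist (clamp u c (f m.+1)) (clamp u c (f m))) ^+ 2 +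
    (excess u c (f n) - excess u c (f 0%N)) ^+ 2
  <= (\sum_(0 <= m < n) edist (f m.+1) (f m)) ^+ 2.
Proof.
move=> u1; elim: n => [|n IH].
  by rewrite !big_nil subrr expr0n addr0.
rewrite !big_nat_recr//=.
rewrite (_ : excess u c (f n.+1) - _ = (excess u c (f n) - excess u c (f 0%N)) +
  (excess u c (f n.+1) - excess u c (f n))); last by ring.
apply: minkowski_step => //; last exact: edist_clamp.
  by apply: sumr_ge0 => i _; exact: edist_ge0.
exact: edist_ge0.
Qed.

Lemma path_length_ge0 (R : realType) (g : R -> 'rV[R]_2) :
  (0 <= path_length g)%E.
Proof.
apply: le_trans (ereal_sup_ubound _); last first.
  by exists [:: 1]; [exact: itv_partition1|reflexivity].
by rewrite lee_fin sumr_ge0// => i _; exact: edist_ge0.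
Qed.

Lemma path_length_clamp (R : realType) (u : 'rV[R]_2) (c : R)
    (g : R -> 'rV[R]_2) (l : R) : dot u u = 1 -> dot u (g 0) <= c ->
  (path_length g <= l%:E)%E ->
  excess u c (g 1) ^+ 2 <= l ^+ 2 /\
  (path_length (clamp u c \o g) <=
    (Num.sqrt (l ^+ 2 - excess u c (g 1) ^+ 2))%:E)%E.
Proof.
move=> u1 g0 gl.
have l0 : 0 <= l by rewrite -lee_fin; exact: le_trans (path_length_ge0 g) gl.
have key s : itv_partition (0 : R) 1 s ->
    (\sum_(0 <= m < size s) edist ((clamp u c \o g) (nth 1 (0 :: s) m.+1))
       ((clamp u c \o g) (nth 1 (0 :: s) m))) ^+ 2 + excess u c (g 1) ^+ 2
    <= l ^+ 2.
  move=> ps.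
  have := @sum_edist_clamp R u c (fun m => g (nth 1 (0 :: s) m)) (size s) u1.
  (* The start has excess 0 and a subdivision ends at 1, so the telescoped change is
     [excess u c (g 1)]. *)
  rewrite (nth_last 1 (0 :: s)) (excess_id g0) subr0 /=.
  case: (ps) => _ /eqP ->; move=> /le_trans; apply.
  rewrite ler_sqr ?nnegrE// ?sumr_ge0// => [|i _]; last exact: edist_ge0.
  by rewrite -lee_fin; apply: le_trans gl; apply: ereal_sup_ubound; exists s.
(* The one-step subdivision suffices. This bound makes the radicand nonnegative; [Num.sqrt] would be
   0 otherwise. *)
have hl : excess u c (g 1) ^+ 2 <= l ^+ 2.
  apply: le_trans (key _ (itv_partition1 ltr01)).
  by rewrite lerDr sqr_ge0.
split => //; apply: ge_ereal_sup => _ [s ps <-].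
rewrite lee_fin -ler_sqr ?nnegrE ?sqrtr_ge0 ?sumr_ge0// => [|i _]; last exact: edist_ge0.
by rewrite sqr_sqrtr ?subr_ge0// lerBrDr key.
Qed.

(** * Admissibility of projected paths and decrease of the obstacle distance *)

Lemma not_interior_halfplane (R : realType) (A : set 'rV[R]_2) (u : 'rV[R]_2)
    (c : R) (z : 'rV[R]_2) :
  dot u u = 1 -> (forall x, A x -> dot u x <= c) -> c <= dot u z ->
  ~ interior A z.
Proof.
move=> u1 Ac cz Az.
(* A point interior to [A] could be pushed slightly along [u] within [A], above level [c]. *)
have k1 := @cst_continuous R 'rV[R]_2 z 0.
have k2 := @cst_continuous R 'rV[R]_2 u 0.
have k3 : {for (0 : R), continuous (@idfun R)} by exact: cvg_id.
have k4 : {for (0 : R), continuous (fun t : R => z + t *: u)} :=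
  continuousD k1 (continuousZ k3 k2).
have : nbhs (0 : R) [set t | A (z + t *: u)].
  by apply: (k4 A); rewrite /= scale0r addr0.
move=> /nbhs_ballP[e /= e0 eA].
have /eA /= /Ac : ball (0 : R) e (e / 2).
  by rewrite /ball /= sub0r normrN gtr0_norm ?divr_gt0// ltr_pdivrMr//; lra.
rewrite dotDr dotZr u1; lra.
Qed.

(** Points in the half-plane do not move; all others land on the line at level [c], which meets no
    polygon interior. *)
Lemma admissible_path_clamp (R : realType) (k : nat) (P : 'I_k -> polygon R)
    (u : 'rV[R]_2) (c : R) (x y : 'rV[R]_2) (g : R -> 'rV[R]_2) :
  dot u u = 1 -> (forall j z, polygon_region (P j) z -> dot u z <= c) ->
  dot u x <= c -> admissible_path P x y g ->
  admissible_path P x (clamp u c y) (clamp u c \o g).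
Proof.
move=> u1 Pc xc [cg g0 g1 gP]; split => /=.
- by move=> t; exact: (continuous_comp (cg t) (@clamp_continuous R u c (g t))).
- by rewrite g0 clamp_id.
- by rewrite g1.
- move=> t j t01; have [gc|gc] := leP (dot u (g t)) c.
    by rewrite clamp_id//; exact: gP.
  by apply: (not_interior_halfplane u1 (Pc j)); rewrite dot_clamp// ltW.
Qed.

Lemma obstacle_dist_ge0 (R : realType) (k : nat) (P : 'I_k -> polygon R)
    (x y : 'rV[R]_2) : (0 <= obstacle_dist P x y)%E.
Proof. by apply: le_ereal_inf_tmp => _ [g _ <-]; exact: path_length_ge0. Qed.

Lemma obstacle_dist_clamp (R : realType) (k : nat) (P : 'I_k -> polygon R)
    (u : 'rV[R]_2) (c : R) (x y : 'rV[R]_2) :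
  dot u u = 1 -> (forall j z, polygon_region (P j) z -> dot u z <= c) ->
  dot u x <= c -> c < dot u y -> (obstacle_dist P x y < +oo)%E ->
  (obstacle_dist P x (clamp u c y) < obstacle_dist P x y)%E.
Proof.
move=> u1 Pc xc yc dfin.
set h := excess u c y.
have h0 : 0 < h by rewrite /h /excess lt_max subr_gt0 yc orbT.
have key g l : admissible_path P x y g -> path_length g = l%:E ->
    h ^+ 2 <= l ^+ 2 /\
    (obstacle_dist P x (clamp u c y) <= (Num.sqrt (l ^+ 2 - h ^+ 2))%:E)%E.
  move=> ag gl; have [_ g0 g1 _] := ag.
  have gx : dot u (g 0) <= c by rewrite g0.
  have /(path_length_clamp u1 gx) : (path_length g <= l%:E)%E by rewrite gl.
  rewrite g1 => -[hl lg]; split => //; apply: le_trans lg.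
  apply: ereal_inf_lbound; exists (clamp u c \o g) => //.
  exact: admissible_path_clamp.
have lfin (g : R -> 'rV[R]_2) : (path_length g < +oo)%E -> path_length g = (fine (path_length g))%:E.
  by move=> gfin; rewrite fineK// ge0_fin_numE ?path_length_ge0.
have [_ [g ag <-] gfin] := ereal_inf_lt dfin.
have [_ dg] := key _ _ ag (lfin _ gfin).
have d'fin : obstacle_dist P x (clamp u c y) \is a fin_num.
  by rewrite ge0_fin_numE ?obstacle_dist_ge0//; exact: le_lt_trans dg (ltry _).
set r := fine (obstacle_dist P x (clamp u c y)).
have r0 : 0 <= r by rewrite fine_ge0// obstacle_dist_ge0.
(* The infimum need not be attained, so a strict gain path by path is not enough. The intermediate
   value [sqrt (r ^+ 2 + h ^+ 2)] exceeds [r] and bounds every path length from below. *)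
apply: (@lt_le_trans _ _ (Num.sqrt (r ^+ 2 + h ^+ 2))%:E).
  rewrite -(fineK d'fin) lte_fin -/r -{1}(ger0_norm r0) -sqrtr_sqr ltr_sqrt.
    by rewrite ltrDl exprn_gt0.
  by rewrite ltr_wpDl ?sqr_ge0// exprn_gt0.
apply: le_ereal_inf_tmp => _ [f af <-].
have [ffin|] := ltP (path_length f) +oo%E; last by rewrite leye_eq => /eqP ->; rewrite leey.
have [hl] := key _ _ af (lfin _ ffin).
rewrite -(fineK d'fin) (lfin _ ffin) /= !lee_fin -/r => rl.
rewrite -[leRHS]ger0_norm ?fine_ge0 ?path_length_ge0// -sqrtr_sqr.
apply: ler_wsqrtr; rewrite -lerBrDr -(@sqr_sqrtr _ (_ - _)) ?subr_ge0//.
by rewrite ler_sqr ?nnegrE ?sqrtr_ge0.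
Qed.

(** * Strict decrease of the total distance *)

Unset Implicit Arguments.
Set Strict Implicit.

Theorem theorem4p11 (R : realType) (k N : nat) (hN : (0 < N)%N)
    (P : 'I_k -> polygon R) (p : 'I_N -> 'rV[R]_2)
    (hp : forall i j, ~ interior (polygon_region (P j)) (p i))
    (q : 'rV[R]_2) (hq : is_minimizer (total_dist P p) q) :
  convex_hull (range p `|` \bigcup_j polygon_region (P j)) q.
Proof.
apply: contrapT => qC.
(* A finite list whose hull is compact and contained in the hull of the statement. *)
pose V := codom p ++ flatten [seq codom (vertex (p := P j)) | j <- enum 'I_k].
have pV i : p i \in V by rewrite mem_cat codom_f.
have vV j i : vertex (p := P j) i \in V.
  rewrite mem_cat; apply/orP; right; apply/flattenP.
  exists (codom (vertex (p := P j))); last exact: codom_f.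
  by apply: map_f; rewrite mem_enum.
have VA : [set` V] `<=` range p `|` \bigcup_j polygon_region (P j).
  move=> x /=; rewrite mem_cat => /orP[/codomP[i ->]|/flattenP[_ /mapP[j _ ->]]].
    by left; exists i.
  case/codomP => i ->; right; exists j => //; left; exists i => //.
  by exists 0; rewrite /= ?in_itv /= ?lexx ?ler01// subr0 scale1r scale0r addr0.
have hV x : x \in V -> convex_hull [set` V] x by move=> xV D [_]; exact.
have [] := @strict_separation R (convex_hull [set` V]) q.
- exact: compact_convex_hull_seq.
- by exists (p (Ordinal hN)); exact: hV.
- exact: convex_convex_hull.
- by move=> /(convex_hull_sub VA).
move=> u [c [u1 Vc cq]].
have Pc j z : polygon_region (P j) z -> dot u z <= c.
  by apply: polygon_region_halfplane => // i; apply: Vc; apply: hV; exact: vV.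
have pc i : dot u (p i) <= c by apply: Vc; apply: hV; exact: pV.
case: hq => Fq Fmin; have := Fmin (clamp u c q); apply/negP; rewrite -ltNge.
have dfin i : (obstacle_dist P (p i) q < +oo)%E.
  apply: le_lt_trans Fq; rewrite /total_dist (bigD1 i)//= leeDl//.
  by apply: sume_ge0 => j _; exact: obstacle_dist_ge0.
have dlt i := obstacle_dist_clamp u1 Pc (pc i) cq (dfin i).
have fin i y : (obstacle_dist P (p i) y < +oo)%E ->
    obstacle_dist P (p i) y = (fine (obstacle_dist P (p i) y))%:E.
  by move=> h; rewrite fineK// ge0_fin_numE ?obstacle_dist_ge0.
rewrite /total_dist.
(* All distances are finite, so the sums are compared in [R]; since [N] is positive, the strict
   inequalities add up to a strict one. *)
under eq_bigr => i _ do rewrite (fin _ _ (lt_trans (dlt i) (dfin i))).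
under [ltRHS]eq_bigr => i _ do rewrite (fin _ _ (dfin i)).
rewrite !sumEFin lte_fin; apply: ltr_sum => [|i _].
  by apply/hasP; exists (Ordinal hN); rewrite ?mem_index_enum.
rewrite -lte_fin -!fin//; exact: lt_trans (dlt i) (dfin i).
Qed.
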